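(* Let $\mathcal U$ denote the set of all (unrestricted) partitions and let $\mathcal R$ denote the set of partitions in which any two parts differ by at least 2. For $\pi\in\mathcal U$ let $\nu_3(\pi)$ denote the number of parts of $\pi$ (counted with multiplicity) that are multiples of 3. For $\tilde\pi\in\mathcal R$ let $\omega_4(\tilde\pi)=2^r$, where $r$ is the number of even chains of $\tilde\pi$. Then, for every $n\ge 0$, $$\sum_{\pi\in\mathcal U,\ \sigma(\pi)=n}(-1)^{\nu_3(\pi)}=\sum_{\tilde\pi\in\mathcal R,\ \sigma(\tilde\pi)=n}\omega_4(\tilde\pi).$$
   Context: For a partition $\pi$, $\sigma(\pi)$ denotes the sum of its parts. In a partition whose parts pairwise differ by at least 2, a chain is a maximal block of parts in which consecutive parts differ by exactly 2; such a partition decomposes uniquely into chains, and all parts of a chain have the same parity. A chain is even if its parts are even. *)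

(* Defs.v *)
From HB Require Import structures.
From mathcomp Require Import all_boot all_order all_algebra.
From mathcomp Require Import zify.

Set Implicit Arguments.
Unset Strict Implicit.
Unset Printing Implicit Defensive.

Definition is_part (s : seq nat) : bool := sorted geq s && (0 \notin s).

(* The partitions of [n], listed as nonincreasing sequences of positive parts. *)
Record intpart (n : nat) := IntPart {
  parts :> seq nat;
  _ : is_part parts && (sumn parts == n)
}.

HB.instance Definition _ n := [isSub for @parts n].
HB.instance Definition _ n := [Countable of intpart n by <:].

Lemma size_le_sumn (s : seq nat) : 0 \notin s -> size s <= sumn s.
Proof. elim: s => //= x s IHs; rewrite inE negb_or => /andP[x0 /IHs]; lia. Qed.

Lemma leq_sumn (s : seq nat) x : x \in s -> x <= sumn s.
Proof. elim: s => //= y s IHs; rewrite inE => /orP[/eqP->|/IHs]; lia. Qed.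

Definition bseq_of_intpart n (p : intpart n) : {bseq n of 'I_n.+1} :=
  insub_bseq n (map inord p).

Definition intpart_of_bseq n (b : {bseq n of 'I_n.+1}) : option (intpart n) :=
  insub (map val b).

Lemma bseq_of_intpartK n : pcancel (@bseq_of_intpart n) (@intpart_of_bseq n).
Proof.
move=> [s hs]; rewrite /intpart_of_bseq /bseq_of_intpart.
have /andP[/andP[_ s0] /eqP sn] := hs.
have size_s : size (map (@inord n) s) <= n.
  by rewrite size_map -[leqRHS]sn size_le_sumn.
rewrite /insub_bseq insubdK ?unfold_in //= -map_comp map_id_in; last first.
  by move=> x xs /=; rewrite inordK // ltnS -[leqRHS]sn leq_sumn.
by rewrite insubT; congr Some; apply: val_inj.
Qed.

HB.instance Definition _ n : isFinite (intpart n) :=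
  PCanIsFinite (@bseq_of_intpartK n).

Definition nu3 (s : seq nat) : nat := count (fun x => 3 %| x) s.

(* As [s] is nonincreasing, the earlier of two parts is the larger one. *)
Definition diff2 (s : seq nat) : bool := pairwise (fun x y => y + 2 <= x) s.

Definition link (x y : nat) : bool := x == y + 2.

Fixpoint chains (s : seq nat) : seq (seq nat) :=
  if s is x :: s' then
    if chains s' is (y :: c) :: cs then
      if link x y then (x :: y :: c) :: cs else [:: x] :: (y :: c) :: cs
    else [:: [:: x]]
  else [::].

(* [chains s] is the unique decomposition of [s] into nonempty blocks of linked
   parts such that no two adjacent blocks can be merged. *)
Definition chain_decomposition (cs : seq (seq nat)) (s : seq nat) : bool :=
  [&& flatten cs == s,
      all (fun c => (c != [::]) && sorted link c) cs
    & sorted (fun c d => ~~ link (last 0 c) (head 0 d)) cs].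

Lemma chainsP s cs : reflect (cs = chains s) (chain_decomposition cs s).
Proof.
apply: (iffP idP) => [|->].
  elim: s cs => [|x s IHs] cs.
    by case: cs => [|[|y c] cs] // /and3P[].
  rewrite /chain_decomposition; case: cs => [|[|y [|z c]] cs].
  - by case/and3P.
  - by case/and3P.
  - case/and3P=> /eqP[-> fl] /= a so.
    have /IHs /= <- : chain_decomposition cs s.
      by rewrite /chain_decomposition fl eqxx a /=; apply: path_sorted so.
    by case: cs so a {fl} => [|[|z c] cs] //= /andP[/negbTE-> _].
  - case/and3P=> /eqP[-> fl] /= /andP[/andP[xz pc] a] so.
    have /IHs /= <- : chain_decomposition ((z :: c) :: cs) s.
      by rewrite /chain_decomposition /= -fl eqxx pc a /=; case: (cs) so.
    by rewrite xz.
elim: s => [|x s] //=; rewrite /chain_decomposition.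
case: (chains s) => [|[|y c] ds] /=.
- by case: s => //= _; rewrite eqxx.
- by rewrite andbF.
case/and3P=> /eqP<- /andP[pc a] so; case: ifP => xy /=.
  by rewrite eqxx xy pc a /=; case: (ds) so.
by rewrite eqxx pc a xy so.
Qed.

Definition even_chain (c : seq nat) : bool := all (fun x => ~~ odd x) c.

Definition omega4 (s : seq nat) : nat := 2 ^ count even_chain (chains s).

(* Main.v *)
Require Import Defs.
From HB Require Import structures.
From mathcomp Require Import all_boot all_order all_algebra.
From mathcomp Require Import zify ring.
Import GRing.Theory Num.Theory.
Local Open Scope ring_scope.

(** Write (x;y)_k for the product of (1 - x y^i) over i < k, and (q)_k for
    (q;q)_k. Both sides of the theorem are coefficients of power series in q. For
    fixed n they are computed in Q[q]/(q^(n+1)), where infinite products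
    and sums are finite and 1 - q^k is invertible for every k > 0.

    Right side. Let the parts of a partition in R be b_1 > ... > b_m and
    subtract from b_i the minimal value 2(m-i)+1. What remains is a
    nonincreasing sequence c of m natural numbers; chains become constant runs
    of c, and a chain is even when the value of its run is odd. A weight 2 for
    each odd value of c means that c is an arbitrary sequence overlaid with a
    set of distinct odd numbers. So the partitions with m parts contribute
    q^(m^2) f_m, where f_m is the coefficient of z^m in
    (-zq;q^2)_oo / (z;q)_oo, that is,
      f_m = sum_j q^(j^2) / ((q)_(m-j) (q^2;q^2)_j).
    On lists this is a recursion on the largest part, solved by a finite form
    of the same coefficient ([diff2_sumSS], [overlay_symS], [diff2_sumE]).

    Summation. Gauss's identity in its finite form ([gauss_finite]) writes
    1/(q^2;q^2)_j as the sum of (-1)^r q^(r^2) / ((q)_(j-r) (q)_(j+r)) over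
    all integers r. Bailey's lemma ([bailey]), which follows from the Durfee
    rectangle identity ([durfee_rectangle]), then performs the sum over j,
    and its limit ([bailey_limit]) the sum over m. Each of the two inserts a
    factor q^(r^2), so the right side is
      1/(q)_oo * sum_r (-1)^r q^(3 r^2),
    and the limit of Gauss's identity ([gauss_limit]), with q^3 for q, gives
      (q^3;q^3)_oo^2 / ((q)_oo (q^6;q^6)_oo).

    Left side. Allowing one more part size k divides the series by
    1 - q^k, or by 1 + q^k if 3 divides k ([sign_sum_gf]). As
    1 + q^(3i) = (1 - q^(6i)) / (1 - q^(3i)), the result is the same product
    ([sign_prod]). *)

Set Implicit Arguments.
Unset Strict Implicit.
Unset Printing Implicit Defensive.

(** * Bailey's lemma and Gauss's identity *)

Lemma sum_ord_shift (V : nmodType) (F : nat -> V) n r : (r <= n)%N ->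
  \sum_(j < n.+1 | (r <= j)%N) F j = \sum_(i < (n - r).+1) F (i + r)%N.
Proof.
move=> le_rn.
rewrite -(big_geq_mkord r n.+1 xpredT F) -{1}[r]add0n big_addn subSn //.
by rewrite big_mkord.
Qed.

Definition qpoch {R : comUnitRingType} (q : R) (k : nat) : R :=
  \prod_(i < k) (1 - q ^+ i.+1).

Section QSeries.
Context (R : comUnitRingType) (q : R).

Local Notation p k := (qpoch q k).
Local Notation e k := (qpoch q k)^-1.

Lemma qpoch0 : p 0 = 1. Proof. exact: big_ord0. Qed.

Lemma qpochS k : p k.+1 = p k * (1 - q ^+ k.+1).
Proof. exact: big_ord_recr. Qed.

Context (unit_q : forall k, 1 - q ^+ k.+1 \is a GRing.unit).

Lemma unit_qpoch k : p k \is a GRing.unit.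
Proof. by apply: rpred_prod => i _; apply: unit_q. Qed.

Lemma invqpochS k : e k = (1 - q ^+ k.+1) * e k.+1.
Proof. by rewrite qpochS invrM ?unit_qpoch // mulrA mulrV // mul1r. Qed.

(** Multiplied by [qpoch q m], both sides count the partitions with at most
    [m + s] parts; on the left, the largest rectangle with [i + s] rows and [i]
    columns in the diagram is cut out. The proof goes by induction on [m]: the
    sum for [m.+1] and [s], times [1 - q ^+ m.+1], is the sum for [m] and
    [s.+1], because
    [1 - q ^+ m.+1 = (1 - q ^+ i) + q ^+ i * (1 - q ^+ (m.+1 - i))]. *)
Lemma durfee_rectangle m s :
  \sum_(i < m.+1) q ^+ (i * (i + s)) * e (m - i) * e i * e (i + s)
  = e m * e (m + s).
Proof.
elim: m s => [|m IHm] s.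
  by rewrite big_ord1 /= mul0n expr0 qpoch0 invr1 !mul1r add0n.
apply: (mulIr (unit_q m)).
rewrite mulrAC (mulrC (e m.+1)) -invqpochS addSnnS -IHm.
have termE (i : 'I_m.+2) : true ->
    q ^+ (i * (i + s)) * e (m.+1 - i) * e i * e (i + s) * (1 - q ^+ m.+1)
  = q ^+ (i * (i + s)) * e (m.+1 - i) * (e i * (1 - q ^+ i)) * e (i + s)
  + q ^+ (i * (i + s)) * ((1 - q ^+ (m.+1 - i)) * e (m.+1 - i))
      * (q ^+ i * e i) * e (i + s).
  move=> _; have -> : q ^+ m.+1 = q ^+ i * q ^+ (m.+1 - i).
    by rewrite -exprD; congr (_ ^+ _); have := ltn_ord i; lia.
  by ring.
(* The first summand vanishes at i = 0 and the second one at i = m + 1; the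
   term i of the result collects the term i + 1 of the first sum and the term
   i of the second. *)
rewrite mulr_suml (eq_bigr _ termE) big_split /= big_ord_recl /= expr0 subrr.
rewrite mulr0 mulr0 mul0r add0r [X in _ + X]big_ord_recr /= subnn expr0 subrr.
rewrite mul0r mulr0 !mul0r addr0 -big_split /=; apply: eq_bigr => i _.
have le_im : (i <= m)%N by rewrite -ltnS.
rewrite /bump /= add1n subSS [_ * (1 - _)]mulrC -invqpochS subSn // -invqpochS.
rewrite (invqpochS (i + s)) addSn addnS.
have -> : q ^+ (i.+1 * (i + s).+1) = q ^+ (i * (i + s).+1) * q ^+ (i + s).+1.
  by rewrite mulSn addnC exprD.
have -> : q ^+ (i * (i + s).+1) = q ^+ (i * (i + s)) * q ^+ i.
  by rewrite mulnS addnC exprD.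
by ring.
Qed.

(** The sequence that forms a Bailey pair with [a], relative to 1. *)
Definition bailey_beta (a : nat -> R) j : R :=
  \sum_(r < j.+1) a r * (e (j - r) * e (j + r)).

(** After exchanging the sums, the inner one is a Durfee rectangle sum with
    [s = 2r], since (i + r)^2 = r^2 + i (i + 2r). *)
Lemma bailey a n :
  \sum_(j < n.+1) q ^+ (j ^ 2) * e (n - j) * bailey_beta a j
  = bailey_beta (fun r => q ^+ (r ^ 2) * a r) n.
Proof.
pose t j r := q ^+ (j ^ 2) * e (n - j) * (a r * (e (j - r) * e (j + r))).
transitivity (\sum_(j < n.+1) \sum_(r < n.+1 | (r <= j)%N) t j r).
  apply: eq_bigr => j _; rewrite mulr_sumr.
  by rewrite (big_ord_widen n.+1 (t j)).
rewrite (exchange_big_dep xpredT) //=; apply: eq_bigr => r _.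
have le_rn : (r <= n)%N by rewrite -ltnS.
rewrite (sum_ord_shift (t^~ r)) // /t.
have -> : (n + r)%N = (n - r + (r + r))%N by lia.
rewrite -durfee_rectangle !mulr_sumr; apply: eq_bigr => i _.
have -> : q ^+ ((i + r) ^ 2) = q ^+ (r ^ 2) * q ^+ (i * (i + (r + r))).
  by rewrite -exprD; congr (_ ^+ _); lia.
rewrite addnK -addnA subnDA subnAC.
by ring.
Qed.

(** The signs of the theta series, a sum of (-1)^r x^(r^2) over all integers
    [r], with the terms [r] and [- r] merged. *)
Definition gauss_coef r : R := (-1) ^+ r *+ (if r == 0%N then 1 else 2).

(** It suffices that the left side at [m] is [1 - q ^+ (2 * m.+1)] times the
    left side at [m.+1]. Over all integers [r], the difference of the two
    telescopes; folded to [r >= 0], the term [r > 0] of the difference is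
    [- (w r - w r.-1) *+ 2] for the [w] below, and the term 0 is
    [- w 0 *+ 2]. *)
Lemma gauss_finite n :
  bailey_beta (fun r => gauss_coef r * q ^+ (r ^ 2)) n = (qpoch (q ^+ 2) n)^-1.
Proof.
suff rec_n m : bailey_beta (fun r => gauss_coef r * q ^+ (r ^ 2)) m
    = (1 - q ^+ (2 * m.+1))
      * bailey_beta (fun r => gauss_coef r * q ^+ (r ^ 2)) m.+1.
  have unit_q2 k : 1 - (q ^+ 2) ^+ k.+1 \is a GRing.unit.
    by rewrite -exprM mulnS addSn unit_q.
  elim: n => [|n IHn].
    by rewrite /bailey_beta big_ord1 /= qpoch0 /qpoch big_ord0 invr1 !mulr1.
  rewrite /qpoch big_ord_recr /= -/(qpoch _ n).
  have unit_p2 : qpoch (q ^+ 2) n \is a GRing.unit.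
    by apply: rpred_prod => i _; apply: unit_q2.
  rewrite invrM // -IHn (rec_n n) -exprM mulrA mulVr ?mul1r //.
  by rewrite exprM unit_q2.
pose c r := q ^+ (r ^ 2) * (e (m.+1 - r) * e (m.+1 + r)).
pose w r := (-1) ^+ r * c r * (q ^+ (m.+1 + r) * (1 - q ^+ (m.+1 - r))).
apply/eqP; rewrite -subr_eq0; apply/eqP.
transitivity (\sum_(r < m.+2) gauss_coef r * (c r
    * (q ^+ (2 * m.+1) + q ^+ (2 * m.+1) - q ^+ (m.+1 - r) - q ^+ (m.+1 + r)))).
  rewrite {2}/bailey_beta mulr_sumr.
  have -> : bailey_beta (fun r => gauss_coef r * q ^+ (r ^ 2)) m
    = \sum_(r < m.+2) gauss_coef r
        * (c r * ((1 - q ^+ (m.+1 - r)) * (1 - q ^+ (m.+1 + r)))).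
    rewrite big_ord_recr /= subnn expr0 subrr mul0r !mulr0 addr0.
    apply: eq_bigr => r _; have le_rm : (r <= m)%N by rewrite -ltnS.
    rewrite (invqpochS (m - r)) (invqpochS (m + r)) /c subSn // addSn.
    by move: (gauss_coef r) => g; ring.
  rewrite -sumrB; apply: eq_bigr => r _.
  have -> : q ^+ (2 * m.+1) = q ^+ (m.+1 - r) * q ^+ (m.+1 + r).
    by rewrite -exprD; congr (_ ^+ _); have := ltn_ord r; lia.
  by rewrite /c; move: (gauss_coef r) => g; ring.
rewrite big_ord_recl /= subn0 addn0.
have termE (i : 'I_m.+1) : true -> gauss_coef (bump 0 i) * (c (bump 0 i)
    * (q ^+ (2 * m.+1) + q ^+ (2 * m.+1) - q ^+ (m.+1 - bump 0 i)
         - q ^+ (m.+1 + bump 0 i)))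
    = - (w i.+1 *+ 2 - w i *+ 2).
  move=> _; rewrite /bump /= add1n /w.
  have le_im : (i <= m)%N by rewrite -ltnS.
  rewrite /c subSS subSn // (invqpochS (m - i)) (invqpochS (m.+1 + i)) addnS.
  have -> : q ^+ (i.+1 ^ 2) = q ^+ (i ^ 2) * q ^+ (i + i).+1.
    by rewrite -exprD; congr (_ ^+ _); lia.
  have -> : q ^+ (m.+1 + i) = q ^+ (m - i) * q ^+ (i + i).+1.
    by rewrite -exprD; congr (_ ^+ _); lia.
  have -> : q ^+ (2 * m.+1) = q ^+ (m - i) * q ^+ (m.+1 + i).+1.
    by rewrite -exprD; congr (_ ^+ _); lia.
  rewrite /gauss_coef /= [(-1) ^+ i.+1]exprS mulN1r !mulr2n.
  move: ((-1) ^+ i) (q ^+ (i ^ 2)) (q ^+ (i + i).+1) (q ^+ (m - i).+1).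
  move: (q ^+ (m - i)) (q ^+ (m.+1 + i).+1) (e (m - i).+1) (e (m.+1 + i).+1).
  by move=> x1 x2 x3 x4 x5 x6 x7 x8; ring.
rewrite (eq_bigr _ termE) sumrN.
rewrite -(big_mkord xpredT (fun i => w i.+1 *+ 2 - w i *+ 2)).
rewrite (telescope_sumr (fun i => w i *+ 2)) //.
have -> : q ^+ (2 * m.+1) = q ^+ m.+1 * q ^+ m.+1.
  by rewrite -exprD; congr (_ ^+ _); lia.
rewrite /w /c /gauss_coef /= subnn subn0 addn0 !expr0 subrr.
rewrite !mulr0 mul0rn.
by ring.
Qed.

End QSeries.

(** * Limits modulo a power of q *)

Section Truncation.
Context (R : comUnitRingType) (q : R) (N : nat) (nil_q : q ^+ N.+1 = 0).

Lemma expr_nil k : (N < k)%N -> q ^+ k = 0.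
Proof. by move=> lt_Nk; rewrite -(subnK lt_Nk) exprD nil_q mulr0. Qed.

Lemma nil_exp k : (q ^+ k.+1) ^+ N.+1 = 0.
Proof. by rewrite -exprM expr_nil // mulSn; lia. Qed.

Lemma unit_1Bnil k : 1 - q ^+ k.+1 \is a GRing.unit.
Proof.
apply/unitrPr; exists (\sum_(i < N.+1) (q ^+ k.+1) ^+ i).
by rewrite -opprB mulNr -subrX1 nil_exp sub0r opprK.
Qed.

(** The infinite product is [qpoch q N]. *)
Lemma qpoch_stable k : (N <= k)%N -> qpoch q k = qpoch q N.
Proof.
move=> le_Nk; rewrite -(subnK le_Nk) addnC.
elim: (k - N)%N => [|d IHd]; first by rewrite addn0.
by rewrite addnS qpochS IHd expr_nil ?subr0 ?mulr1 // ltnS leq_addr.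
Qed.

End Truncation.

Lemma sum_truncate (V : nmodType) (F : nat -> V) N n : (N <= n)%N ->
  (forall i, (N < i)%N -> F i = 0) ->
  \sum_(i < n.+1) F i = \sum_(i < N.+1) F i.
Proof.
move=> le_Nn F0; rewrite -(big_mkord xpredT F) (big_cat_nat (n := N.+1)) //=.
rewrite [X in _ + X]big_nat_cond [X in _ + X]big1 ?addr0 ?big_mkord //.
by move=> i /andP[/andP[lt_Ni _] _]; apply: F0.
Qed.

Section Limits.
Context (R : comUnitRingType) (q : R) (N : nat) (nil_q : q ^+ N.+1 = 0).

Local Notation e k := (qpoch q k)^-1.

Let unit_q := unit_1Bnil nil_q.

Lemma expr_sqr_nil i : (N < i)%N -> q ^+ (i ^ 2) = 0.
Proof.
by move=> lt_Ni; rewrite (expr_nil nil_q) // (leq_trans lt_Ni) // leq_pmulr; lia.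
Qed.

(** This is [bailey] at [n = N + N]: for the indices up to [N], the only ones
    that count, [n - j], [n - r] and [n + r] are at least [N]. *)
Lemma bailey_limit (a : nat -> R) :
  \sum_(j < N.+1) q ^+ (j ^ 2) * bailey_beta q a j
  = e N * \sum_(r < N.+1) q ^+ (r ^ 2) * a r.
Proof.
have := bailey unit_q a (N + N).
rewrite (@sum_truncate _
  (fun j => q ^+ (j ^ 2) * e (N + N - j) * bailey_beta q a j) N)
  ?leq_addl //; last by move=> i /expr_sqr_nil ->; rewrite !mul0r.
rewrite /(bailey_beta _ _ (N + N)) (@sum_truncate _
  (fun r => q ^+ (r ^ 2) * a r * (e (N + N - r) * e (N + N + r))) N)
  ?leq_addl //; last by move=> i /expr_sqr_nil ->; rewrite !mul0r.
have eE (r : 'I_N.+1) : e (N + N - r) = e N.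
  by rewrite (qpoch_stable nil_q) //; have := ltn_ord r; lia.
under eq_bigr do rewrite eE mulrAC mulrC.
under [X in _ = X]eq_bigr => r _.
  rewrite eE (qpoch_stable nil_q (k := N + N + r)); last lia.
  rewrite mulrC; over.
rewrite -!mulr_sumr -mulrA; apply: mulrI.
by rewrite unitrV unit_qpoch.
Qed.

Lemma gauss_limit :
  \sum_(r < N.+1) gauss_coef R r * q ^+ (r ^ 2)
  = qpoch q N ^+ 2 / qpoch (q ^+ 2) N.
Proof.
have := gauss_finite unit_q (N + N).
rewrite (qpoch_stable (nil_exp nil_q 1)) ?leq_addl // => <-.
rewrite /bailey_beta (@sum_truncate _ (fun r =>
  gauss_coef R r * q ^+ (r ^ 2) * (e (N + N - r) * e (N + N + r))) N)
  ?leq_addl //; last by move=> i /expr_sqr_nil ->; rewrite mulr0 mul0r.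
rewrite mulr_sumr; apply: eq_bigr => r _.
rewrite !(qpoch_stable nil_q); [|lia|by have := ltn_ord r; lia].
have u := unit_qpoch unit_q N.
by rewrite mulrCA -invrM // -expr2 mulrV ?mulr1 // unitrX.
Qed.

End Limits.

(** * Symmetric functions of powers of q *)

Section Symmetric.
Context (R : comUnitRingType).
Implicit Type q : R.

(** The complete homogeneous symmetric polynomial of degree [m] in 1, q, ...,
    q^k, which is also the Gaussian binomial of [m + k] and [k]. *)
Fixpoint complete_sym q m : nat -> R :=
  if m is m'.+1 then
    fix sum_k k :=
      if k is k'.+1 then sum_k k' + q ^+ k * complete_sym q m' k else 1
  else fun=> 1.

(** The elementary symmetric polynomial of degree [j] in the first [k] odd
    powers q, q^3, ..., q^(2k-1). *)
Fixpoint odd_elem_sym q k j : R :=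
  match k, j with
  | _, 0 => 1
  | 0, _.+1 => 0
  | k'.+1, j'.+1 =>
      odd_elem_sym q k' j + q ^+ k'.*2.+1 * odd_elem_sym q k' j'
  end.

Lemma complete_symS q m k : complete_sym q m.+1 k.+1
  = complete_sym q m.+1 k + q ^+ k.+1 * complete_sym q m k.+1.
Proof. by []. Qed.

Lemma odd_elem_symS q k j : odd_elem_sym q k.+1 j.+1
  = odd_elem_sym q k j.+1 + q ^+ k.*2.+1 * odd_elem_sym q k j.
Proof. by []. Qed.

Lemma odd_elem_sym_lt q k j : (k < j)%N -> odd_elem_sym q k j = 0.
Proof.
elim: k j => [|k IHk] [|j] //= lt_kj.
by rewrite !IHk ?mulr0 ?addr0 //; lia.
Qed.

(** Subtracting 1, 3, ..., 2j-1 from [j] distinct odd numbers below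
    2(j + c) leaves [j] even numbers between 0 and 2c. *)
Lemma odd_elem_symE q j c :
  odd_elem_sym q (j + c) j = q ^+ (j ^ 2) * complete_sym (q ^+ 2) j c.
Proof.
elim: j c => [|j IHj] c; first by case: c => [|c]; rewrite /= mulr1.
elim: c => [|c IHc].
  rewrite addn0 odd_elem_symS odd_elem_sym_lt // add0r -{2}[j]addn0 IHj.
  have -> : complete_sym (q ^+ 2) j 0 = 1 by case: j {IHj}.
  by rewrite !mulr1 -exprD; congr (_ ^+ _); lia.
rewrite addnS odd_elem_symS IHc complete_symS mulrDr; congr (_ + _).
rewrite [X in odd_elem_sym _ X j]addSnnS IHj !mulrA -exprM -!exprD.
by congr (_ ^+ _ * _); lia.
Qed.

(** The coefficient of z^m in the product of the 1 + z q^i over the odd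
    [i <= k], divided by the product of the 1 - z q^i over all [i <= k]. It
    counts nonincreasing sequences of [m] numbers in 0, ..., k, with weight 2
    for each odd value that occurs. *)
Definition overlay_sym q m k : R :=
  \sum_(j < m.+1) odd_elem_sym q (uphalf k) j * complete_sym q (m - j) k.

Lemma overlay_sym_size0 q k : overlay_sym q 0 k = 1.
Proof.
by rewrite /overlay_sym big_ord1 /=; case: uphalf => *; rewrite mulr1.
Qed.

Lemma overlay_sym_bound0 q m : overlay_sym q m 0 = 1.
Proof.
rewrite /overlay_sym big_ord_recl big1 => [|i _] /=; last by rewrite mul0r.
by case: m => [|m]; rewrite addr0 mulr1.
Qed.

(** Passing from [k] to [k.+1] multiplies the generating function in z by
    1/(1 - z q^(k+1)), and also by 1 + z q^(k+1) if [k.+1] is odd. *)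
Lemma overlay_symS q m k :
  overlay_sym q m.+1 k.+1 = overlay_sym q m.+1 k + q ^+ k.+1
    * (overlay_sym q m k.+1 + (if odd k then 0 else overlay_sym q m k)).
Proof.
rewrite {1}/overlay_sym.
transitivity (\sum_(j < m.+2)
    odd_elem_sym q (uphalf k.+1) j * complete_sym q (m.+1 - j) k
  + q ^+ k.+1 * overlay_sym q m k.+1).
  rewrite big_ord_recr [X in _ = X + _]big_ord_recr /= subnn /= addrAC.
  congr (_ + _).
  rewrite /overlay_sym mulr_sumr -big_split /=; apply: eq_bigr => j _.
  rewrite subSn; last by rewrite -ltnS.
  by rewrite /=; ring.
rewrite mulrDr [RHS]addrCA [LHS]addrC; congr (_ + _).
rewrite uphalf_half; case: ifP => odd_k /=.
  by rewrite mulr0 addr0 /overlay_sym uphalf_half odd_k.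
rewrite /overlay_sym big_ord_recl [X in _ = X + _]big_ord_recl /= -addrA.
congr (_ + _); first by rewrite uphalf_half odd_k; case: half.
rewrite mulr_sumr -big_split /=; apply: eq_bigr => j _.
rewrite /bump /= !add1n subSS uphalf_half odd_k !add0n.
rewrite [(~~ false + _)%N]add1n odd_elem_symS.
have -> : k./2.*2 = k by rewrite -[RHS]odd_double_half odd_k.
by ring.
Qed.

Lemma complete_symE q m k :
  complete_sym q m k * (qpoch q m * qpoch q k) = qpoch q (m + k).
Proof.
elim: m k => [|m IHm] k; first by rewrite /= qpoch0 !mul1r.
elim: k => [|k IHk]; first by rewrite /= qpoch0 !mul1r mulr1 addn0.
transitivity
  (complete_sym q m.+1 k * (qpoch q m.+1 * qpoch q k) * (1 - q ^+ k.+1)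
   + q ^+ k.+1 * (complete_sym q m k.+1 * (qpoch q m * qpoch q k.+1))
     * (1 - q ^+ m.+1)).
  by rewrite [qpoch q m.+1]qpochS [qpoch q k.+1]qpochS complete_symS; ring.
rewrite IHk IHm -(addSnnS m k) (addnS m.+1 k) qpochS.
have -> : q ^+ (m.+1 + k).+1 = q ^+ m.+1 * q ^+ k.+1 by rewrite -exprD addnS.
by ring.
Qed.

Lemma complete_sym_limit q N m k : q ^+ N.+1 = 0 -> (N <= k)%N ->
  complete_sym q m k = (qpoch q m)^-1.
Proof.
move=> nil_q le_Nk; have := complete_symE q m k.
have u := unit_qpoch (unit_1Bnil nil_q).
rewrite mulrA (qpoch_stable nil_q (k := m + k)); last by lia.
rewrite (qpoch_stable nil_q le_Nk) => /(canRL (mulrK (u N))).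
by rewrite mulrV // => /(canRL (mulrK (u m))); rewrite mul1r.
Qed.

Lemma odd_elem_sym_limit q N k j : q ^+ N.+1 = 0 -> (j + N <= k)%N ->
  odd_elem_sym q k j = q ^+ (j ^ 2) / qpoch (q ^+ 2) j.
Proof.
move=> nil_q le_k; have le_jk : (j <= k)%N by lia.
rewrite -(subnKC le_jk) odd_elem_symE (complete_sym_limit _ (nil_exp nil_q 1)) //.
by lia.
Qed.

(** In the limit, [overlay_sym] is a convolution of 1/(q)_i with
    q^(j^2)/(q^2;q^2)_j; the latter is q^(j^2) times a Bailey sequence by
    Gauss's identity, so Bailey's lemma applies. *)
Lemma overlay_sym_limit q N m k :
  q ^+ N.+1 = 0 -> (m <= N)%N -> (4 * N <= k)%N ->
  overlay_sym q m k
  = bailey_beta q (fun r => q ^+ (r ^ 2) * (gauss_coef R r * q ^+ (r ^ 2))) m.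
Proof.
move=> nil_q le_mN le_Nk; have unit_q := unit_1Bnil nil_q.
rewrite -bailey //; apply: eq_bigr => j _.
have le_jm : (j <= m)%N by rewrite -ltnS.
rewrite gauss_finite // (odd_elem_sym_limit nil_q); last lia.
rewrite (complete_sym_limit _ nil_q); last lia.
by rewrite mulrAC.
Qed.

End Symmetric.

(** * Lists of partitions *)

(** Listing partitions by their number [m] of parts and a bound [k] on the
    parts makes the case distinction on the largest part an equation between
    lists, and makes the sum m^2 of the minimal parts a constant. *)
Fixpoint parts_le k : nat -> seq (seq nat) :=
  if k is k'.+1 then
    fix parts_eq_size m :=
      if m is m'.+1 then parts_le k' m ++ map (cons k) (parts_eq_size m')
      else [:: [::]]
  else fun m => if m is 0 then [:: [::]] else [::].

Lemma parts_le_0 k : parts_le k 0 = [:: [::]].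
Proof. by case: k. Qed.

Lemma parts_leSS k m :
  parts_le k.+1 m.+1 = parts_le k m.+1 ++ map (cons k.+1) (parts_le k.+1 m).
Proof. by []. Qed.

Lemma parts_le_0S m : parts_le 0 m.+1 = [::].
Proof. by []. Qed.

Arguments parts_le : simpl never.

Lemma mem_parts_le k m s : (s \in parts_le k m) =
  [&& is_part s, size s == m & all (fun x => (x <= k)%N) s].
Proof.
elim: k m s => [|k IHk] m s.
  case: m s => [|m] [|[|x] s]; rewrite ?parts_le_0 ?parts_le_0S /is_part;
    by rewrite ?in_nil ?mem_seq1 /= ?andbF.
elim: m s => [|m IHm] s.
  by rewrite parts_le_0 mem_seq1; case: s => //= x s; rewrite andbF.
rewrite parts_leSS mem_cat IHk; case: s => [|x s] /=.
  by apply/negbTE/negP => /mapP [].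
have -> : (x :: s \in [seq k.+1 :: i | i <- parts_le k.+1 m]) =
          (x == k.+1) && (s \in parts_le k.+1 m).
  apply/mapP/andP => [[t t_in [-> ->]]|[/eqP -> s_in]]; first by rewrite eqxx.
  by exists s.
rewrite IHm /is_part /= inE negb_or eqSS.
have [->|ne_xk] /= := eqVneq x k.+1; last first.
  rewrite orbF; have le_x : (x <= k.+1)%N = (x <= k)%N by lia.
  rewrite le_x; have [le_xk|] := leqP x k; rewrite ?andbF //=.
  case: (boolP (path geq x s)); rewrite ?andbF //= => path_s.
  congr [&& _, _ & _].
  have /allP le_s : all (geq x) s.
    by apply: order_path_min path_s; move=> a b c /=; lia.
  apply/allP/allP => le_all y y_in; have := le_s y y_in;
    by have := le_all y y_in => /=; lia.
rewrite ltnn !andbF leqnn /=.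
have -> : path geq k.+1 s = all (leq^~ k.+1) s && sorted geq s.
  by apply: path_sortedE => a b c /=; lia.
by case: all; rewrite // !andbF.
Qed.

Lemma uniq_parts_le k m : uniq (parts_le k m).
Proof.
elim: k m => [|k IHk] m; first by case: m.
elim: m => [|m IHm] //; rewrite parts_leSS cat_uniq IHk.
rewrite map_inj_uniq ?IHm; last by move=> s t [].
rewrite andbT; apply/hasPn => _ /mapP [s _ ->].
by rewrite mem_parts_le /= ltnn !andbF.
Qed.

Lemma big_parts_leSS (V : nmodType) k m (P : pred (seq nat))
    (F : seq nat -> V) :
  \sum_(s <- parts_le k.+1 m.+1 | P s) F s
  = \sum_(s <- parts_le k m.+1 | P s) F s
    + \sum_(s <- parts_le k.+1 m | P (k.+1 :: s)) F (k.+1 :: s).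
Proof. by rewrite parts_leSS big_cat big_map. Qed.

Lemma sum_intpart (V : nmodType) n k (P : pred (seq nat))
    (F : seq nat -> V) : (n <= k)%N ->
  \sum_(p : intpart n | P p) F p
  = \sum_(m < n.+1) \sum_(s <- parts_le k m | P s && (sumn s == n)) F s.
Proof.
move=> le_nk.
have size_p (p : intpart n) : (size p < n.+1)%N.
  have := valP p => /andP [/andP [_ p0] /eqP sum_p].
  by rewrite ltnS -[leqRHS]sum_p size_le_sumn.
rewrite (partition_big (fun p => Ordinal (size_p p)) xpredT) //=.
apply: eq_bigr => m _.
rewrite -big_filter -[RHS]big_filter -(big_map (@parts n) xpredT F).
apply: perm_big; apply: uniq_perm.
- rewrite (map_inj_uniq val_inj).
  by rewrite filter_uniq // index_enum_uniq.
- by rewrite filter_uniq // uniq_parts_le.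
move=> s; rewrite mem_filter mem_parts_le; apply/mapP/idP.
  move=> [p]; rewrite mem_filter => /andP [/andP [Pp /eqP <-] _] ->.
  have /andP [pp sum_p] := valP p; rewrite Pp sum_p pp eqxx /=.
  by apply/allP => x /leq_sumn; rewrite (eqP sum_p) => /leq_trans ->.
move=> /andP [/andP [Ps sum_s] /and3P [s_part size_s _]].
have ps : is_part s && (sumn s == n) by rewrite s_part.
exists (IntPart ps) => //.
by rewrite mem_filter mem_index_enum andbT Ps; apply/eqP/val_inj/eqP.
Qed.

(** * The weighted sum over partitions with gaps at least 2 *)

Lemma chains_cons y s : exists c cs, chains (y :: s) = (y :: c) :: cs.
Proof.
rewrite /=; case: (chains s) => [|[|z c] cs]; try by exists [::], [::].
by case: ifP => _; [exists (z :: c), cs|exists [::], ((z :: c) :: cs)].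
Qed.

Lemma omega4_linked y s : omega4 [:: y.+2, y & s] = omega4 (y :: s).
Proof.
rewrite /omega4 [chains (y.+2 :: _)]/=.
have [c [cs /= ->]] := chains_cons y s.
by rewrite /link addn2 eqxx /= negbK andbA andbb.
Qed.

Lemma omega4_cons x s : (head 0 s + 2 < x)%N || (s == [::]) ->
  omega4 (x :: s) = (2 ^ (~~ odd x) * omega4 s)%N.
Proof.
case: s => [_|y s] //=.
  by rewrite /omega4 /= andbT addn0 expn0 muln1.
rewrite orbF => lt_yx; rewrite /omega4 [chains (x :: _)]/=.
have [c [cs /= ->]] := chains_cons y s.
rewrite /link ifF /=; last by apply/negbTE; lia.
by rewrite andbT expnD.
Qed.

Section Diff2.
Context (R : comUnitRingType) (q : R).

Definition diff2_sum k m : R :=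
  \sum_(s <- parts_le k m | diff2 s) (omega4 s)%:R * q ^+ sumn s.

Lemma diff2_sum_0 k : diff2_sum k 0 = 1.
Proof. by rewrite /diff2_sum parts_le_0 big_mkcond big_seq1 /= mulr1. Qed.

Lemma diff2_sum_0S m : diff2_sum 0 m.+1 = 0.
Proof. exact: big_nil. Qed.

Lemma sum_cons_diff2 k m (F : seq nat -> R) :
  \sum_(s <- parts_le k.+1 m | diff2 (k.+1 :: s)) F s
  = \sum_(s <- parts_le k.-1 m | diff2 s) F s.
Proof.
case: m => [|m]; first by rewrite !parts_le_0 !big_cons !big_nil.
rewrite big_parts_leSS [X in _ + X]big_pred0 ?addr0; last first.
  by move=> s; rewrite /diff2 /= addn2 ltnNge leqnSn.
case: k => [|k]; first by rewrite !parts_le_0S !big_nil.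
rewrite big_parts_leSS [X in _ + X]big_pred0 ?addr0; last first.
  by move=> s; rewrite /diff2 /= addn2 ltnn.
rewrite /= big_seq_cond [RHS]big_seq_cond; apply: eq_bigl => s.
rewrite mem_parts_le; case: (boolP (all _ s)); rewrite ?andbF // !andbT => le_s.
congr (_ && _); rewrite /diff2 /=.
suff -> : all (fun y => (y + 2 <= k.+2)%N) s by [].
by apply: sub_all le_s => y /=; lia.
Qed.

(** Adding the part [k.+1] in front changes the weight only if [k.+1] is even
    and starts a new chain, that is, if the parts in [s] are at most [k.-2]; it
    then doubles the weight. *)
Lemma sum_omega4_cons k m :
  \sum_(s <- parts_le k.-1 m | diff2 s) (omega4 (k.+1 :: s))%:R * q ^+ sumn s
  = diff2_sum k.-1 m + (if odd k then diff2_sum k.-2 m else 0).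
Proof.
case: m => [|m].
  rewrite !diff2_sum_0 parts_le_0 big_mkcond big_seq1 omega4_cons ?orbT //=.
  rewrite negbK.
  by case: odd; rewrite /= mulr1 ?addr0 // -natrD.
have far j : (j < k.-1)%N || (j == 0%N) ->
    \sum_(s <- parts_le j m.+1 | diff2 s)
      (omega4 (k.+1 :: s))%:R * q ^+ sumn s
    = diff2_sum j m.+1 *+ 2 ^ odd k.
  case: j => [|j]; first by rewrite /diff2_sum !parts_le_0S !big_nil mul0rn.
  rewrite orbF => lt_jk; rewrite -sumrMnl big_seq_cond [RHS]big_seq_cond.
  apply: eq_bigr => s /andP [].
  rewrite mem_parts_le => /and3P [_ _ /allP le_s] _.
  rewrite omega4_cons /= ?negbK; last first.
    case: s le_s => [|y s] le_s /=; first by rewrite orbT.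
    by have := le_s y; rewrite inE eqxx; lia.
  by rewrite natrM -mulr_natr; ring.
(* For k = 0 and k = 1 both bounds k.-1 and k.-2 are 0. *)
case: k far => [|[|k]] far; rewrite /= ?negbK.
- by rewrite far // addr0.
- by rewrite far // mulr2n.
rewrite big_parts_leSS far ?ltnSn // [in RHS]/diff2_sum big_parts_leSS /= negbK.
rewrite [X in _ + X](eq_bigr (fun s =>
  (omega4 (k.+1 :: s))%:R * q ^+ (k.+1 + sumn s))) => [|s _]; last first.
  by rewrite omega4_linked.
rewrite -/(diff2_sum k m.+1) addrAC; congr (_ + _).
by case: odd; rewrite /= ?mulr2n ?addr0.
Qed.

Lemma diff2_sumSS k m : diff2_sum k.+1 m.+1 = diff2_sum k m.+1
  + q ^+ k.+1 * (diff2_sum k.-1 m + (if odd k then diff2_sum k.-2 m else 0)).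
Proof.
rewrite {1}/diff2_sum big_parts_leSS -sum_omega4_cons; congr (_ + _).
rewrite sum_cons_diff2 mulr_sumr; apply: eq_bigr => s _.
by rewrite /= exprD; ring.
Qed.

(** The largest of [m] parts with gaps at least 2 is at least 2m - 1. *)
Lemma diff2_sum_lt k m : (k.+1 < m.*2)%N -> diff2_sum k m = 0.
Proof.
elim: m k => [|m IHm] // k; elim: k => [|k IHk] lt_km.
  exact: diff2_sum_0S.
by rewrite diff2_sumSS IHk ?IHm ?add0r ?if_same ?mulr0 //; lia.
Qed.

(** Subtracting 1, 3, ..., 2m-1 from the [m] parts reduces their sum by m^2
    and turns each even chain into an odd value; a largest part bounded by
    k + 2m - 1 becomes a value bounded by [k]. *)
Lemma diff2_sumE k m :
  diff2_sum (k + m.*2).-1 m = q ^+ (m ^ 2) * overlay_sym q m k.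
Proof.
elim: m k => [|m IHm] k.
  by rewrite diff2_sum_0 overlay_sym_size0 mulr1.
have sqrS : (m.+1 ^ 2 = m.*2.+1 + m ^ 2)%N by lia.
elim: k => [|k IHk].
  rewrite diff2_sumSS diff2_sum_lt // add0r odd_double addr0.
  rewrite -[m.*2.-1]/((0 + m.*2).-1) IHm !overlay_sym_bound0 !mulr1.
  by rewrite -exprD sqrS.
have -> : (k.+1 + m.+1.*2).-1 = (k + m.+1.*2).-1.+1 by lia.
rewrite diff2_sumSS IHk overlay_symS [RHS]mulrDr; congr (_ + _).
have -> : (k + m.+1.*2).-1.-1 = (k.+1 + m.*2).-1 by lia.
have -> : (k.+1 + m.*2).-1.-1 = (k + m.*2).-1 by lia.
have -> : odd (k + m.+1.*2).-1 = ~~ odd k by lia.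
rewrite !IHm if_neg.
have -> : q ^+ (k + m.+1.*2).-1.+1 = q ^+ k.+1 * q ^+ m.*2.+1.
  by rewrite -exprD; congr (_ ^+ _); lia.
by rewrite sqrS exprD; case: odd; ring.
Qed.

(** Any bound on the parts from some point on gives the same sum; [6 * N] is
    large enough for [overlay_sym_limit] and a multiple of 3, as the product
    on the other side of the theorem requires. *)
Lemma diff2_gf N : q ^+ N.+1 = 0 ->
  \sum_(m < N.+1) diff2_sum (6 * N) m
  = qpoch (q ^+ 3) N ^+ 2 / (qpoch q N * qpoch (q ^+ 6) N).
Proof.
move=> nil_q; have nil3 := nil_exp nil_q 2.
transitivity ((qpoch q N)^-1
    * \sum_(r < N.+1) gauss_coef R r * (q ^+ 3) ^+ (r ^ 2)).
  transitivity (\sum_(m < N.+1) q ^+ (m ^ 2) * bailey_beta q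
      (fun r => q ^+ (r ^ 2) * (gauss_coef R r * q ^+ (r ^ 2))) m).
    apply: eq_bigr => m _; have le_mN : (m <= N)%N by rewrite -ltnS.
    have -> : (6 * N)%N = ((6 * N).+1 - m.*2 + m.*2).-1 by lia.
    by rewrite diff2_sumE (overlay_sym_limit nil_q) //; lia.
  rewrite (bailey_limit nil_q); congr (_ * _); apply: eq_bigr => r _.
  rewrite -exprM.
  have -> : (3 * r ^ 2 = r ^ 2 + (r ^ 2 + r ^ 2))%N by lia.
  by rewrite !exprD; ring.
rewrite (gauss_limit nil3) -exprM invrM; first by ring.
  exact: unit_qpoch (unit_1Bnil nil_q) N.
exact: unit_qpoch (unit_1Bnil (nil_exp nil_q 5)) N.
Qed.

End Diff2.

(** * The signed sum over all partitions *)

Section Sign.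
Context (R : comUnitRingType) (q : R) (N : nat) (nil_q : q ^+ N.+1 = 0).

Definition sign_sum k m : R :=
  \sum_(s <- parts_le k m) (-1) ^+ nu3 s * q ^+ sumn s.

(** A nonempty partition counted on the left either has all its parts at most
    [k], or comes from a shorter one by adding a part [k.+1]; multiplying by
    the last factor cancels the second kind. *)
Lemma sign_sum_gfS k :
  (\sum_(m < N.+1) sign_sum k.+1 m)
    * (1 - (-1) ^+ (3 %| k.+1) * q ^+ k.+1)
  = \sum_(m < N.+1) sign_sum k m.
Proof.
rewrite mulrBr mulr1 [X in _ - X * _]big_ord_recr /= mulrDl.
(* N parts and one more have a sum larger than N. *)
have -> : sign_sum k.+1 N * ((-1) ^+ (3 %| k.+1) * q ^+ k.+1) = 0.
  rewrite /sign_sum mulr_suml big_seq big1 // => s.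
  rewrite mem_parts_le => /and3P [/andP [_ /size_le_sumn le_s] /eqP size_s _].
  rewrite mulrACA -(exprD q) (expr_nil nil_q) ?mulr0 // addnS ltnS -size_s.
  exact: leq_trans le_s (leq_addr _ _).
rewrite addr0 big_ord_recl [RHS]big_ord_recl /= /sign_sum !parts_le_0 -addrA.
congr (_ + _); rewrite mulr_suml -sumrB; apply: eq_bigr => m _.
rewrite /bump /= add1n parts_leSS big_cat big_map /= mulr_suml -addrA.
rewrite -[RHS]addr0 -sumrB; congr (_ + _); rewrite big1 // => s _.
by rewrite !exprD; ring.
Qed.

Lemma sign_sum_gf k :
  (\sum_(m < N.+1) sign_sum k m)
    * \prod_(i < k) (1 - (-1) ^+ (3 %| i.+1) * q ^+ i.+1) = 1.
Proof.
elim: k => [|k IHk]; last first.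
  by rewrite [X in _ * X]big_ord_recr /= mulrA mulrAC sign_sum_gfS.
rewrite [X in _ * X]big_ord0 mulr1 big_ord_recl big1 => [|m _]; last first.
  exact: big_nil.
by rewrite /sign_sum parts_le_0 big_seq1 !mulr1 addr0.
Qed.

End Sign.

(** The factors 1 + q^(3i) of the first product combine with 1 - q^(3i) to
    1 - q^(6i), and its other factors combine with the second power of
    1 - q^(3i) to all the 1 - q^i. *)
Lemma sign_prod (R : comUnitRingType) (q : R) k :
  \prod_(i < 3 * k) (1 - (-1) ^+ (3 %| i.+1) * q ^+ i.+1)
    * qpoch (q ^+ 3) k ^+ 2
  = qpoch q (3 * k) * qpoch (q ^+ 6) k.
Proof.
elim: k => [|k IHk]; first by rewrite muln0 !qpoch0 big_ord0 expr1n.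
rewrite mulnS !(big_ord_recr, qpochS) /= -!exprM.
have -> : (3 %| (3 * k).+1)%N = false by lia.
have -> : (3 %| (3 * k).+2)%N = false by lia.
have -> : (3 %| (3 * k).+3)%N by lia.
have -> : (6 * k.+1 = (3 * k).+3 + (3 * k).+3)%N by lia.
have -> : (3 * k.+1 = (3 * k).+3)%N by lia.
rewrite [q ^+ (_ + _)]exprD.
rewrite -/(qpoch q (3 * k)) exprMn.
set a := \prod_(i < _) _ in IHk *.
transitivity (a * qpoch (q ^+ 3) k ^+ 2
  * ((1 - q ^+ (3 * k).+1) * (1 - q ^+ (3 * k).+2) * (1 - q ^+ (3 * k).+3)
     * (1 - q ^+ (3 * k).+3 * q ^+ (3 * k).+3))).
  by move: (qpoch _ _) (q ^+ _) (q ^+ _) (q ^+ _) => b c d f; ring.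
rewrite IHk.
by ring.
Qed.

Lemma sign_sum_diff2_sum (R : comUnitRingType) (q : R) N : q ^+ N.+1 = 0 ->
  \sum_(m < N.+1) sign_sum q (6 * N) m
  = \sum_(m < N.+1) diff2_sum q (6 * N) m.
Proof.
move=> nil_q; rewrite diff2_gf //.
have := sign_sum_gf nil_q (6 * N); have := sign_prod q (2 * N).
rewrite mulnA (qpoch_stable nil_q) 1?(qpoch_stable (nil_exp nil_q 2));
  [|lia|lia].
rewrite (qpoch_stable (nil_exp nil_q 5)); last lia.
set a := \prod_(i < _) _ => prodE gfE.
have u1 := unit_qpoch (unit_1Bnil nil_q) N.
have u2 := unit_qpoch (unit_1Bnil (nil_exp nil_q 5)) N.
apply: (canRL (mulrK _)); first by rewrite unitrM u1.
by rewrite -prodE mulrA gfE mul1r.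
Qed.

(** * The coefficient of q^n *)

Theorem theorem4 (n : nat) :
  \sum_(p : intpart n) (-1) ^+ nu3 p =
  \sum_(p : intpart n | diff2 p) (omega4 p)%:Z.
Proof.
pose R := {poly %/ ('X^(n.+1) : {poly rat})}; pose q : R := 'qX.
have mkE : mk_monic ('X^(n.+1) : {poly rat}) = 'X^(n.+1) by rewrite mk_monic_Xn.
have nil_q : q ^+ n.+1 = 0.
  apply: val_inj; rewrite /q /qpolyX -rmorphXn /= mkE.
  by rewrite Pdiv.RingMonic.rmodpp ?monicXn.
have qE k : (q ^+ k : {poly rat})`_n = (k == n)%:R.
  have [le_kn|lt_nk] := leqP k n.
    rewrite /q /qpolyX -rmorphXn in_qpoly_small; first by rewrite coefXn eq_sym.
    by rewrite mkE !size_polyXn !ltnS.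
  by rewrite (expr_nil nil_q lt_nk) coef0; case: eqP lt_nk => // ->; rewrite ltnn.
have le_n6n : (n <= 6 * n)%N by lia.
have coefS (P : pred (seq nat)) (c : seq nat -> int) :
    ((\sum_(m < n.+1) \sum_(s <- parts_le (6 * n) m | P s)
        (c s)%:~R * q ^+ sumn s : R) : {poly rat})`_n
  = (\sum_(p : intpart n | P p) c p)%:~R.
  rewrite (sum_intpart P c le_n6n) poly_of_qpoly_sum coef_sum [RHS]rmorph_sum.
  apply: eq_bigr => m _; rewrite poly_of_qpoly_sum coef_sum [RHS]rmorph_sum.
  rewrite [RHS]big_mkcondr; apply: eq_bigr => s _.
  rewrite mulrzl -scaler_int poly_of_qpolyZ coefZ qE.
  by case: eqP; rewrite ?mulr1 ?mulr0.
apply: (@intr_inj rat).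
refine (etrans (esym (coefS xpredT (fun s => (-1) ^+ nu3 s))) _).
refine (etrans _ (coefS diff2 (fun s => (omega4 s)%:Z))).
congr (polyn _)`_n; have := sign_sum_diff2_sum nil_q.
rewrite /sign_sum /diff2_sum.
under eq_bigr do under eq_bigr do
  rewrite -[(-1) ^+ _](rmorph_sign (intr : int -> R)).
move->; apply: eq_bigr => m _; apply: eq_bigr => s _.
by rewrite pmulrn.
Qed.
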